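(* Let $G=(V,E)$ be an oriented graph with $V=\{1,\dots,n\}$ and let $D$ be a set of unordered pairs of distinct non-adjacent vertices of $G$. Define the matrix $\mathcal{M}=\mathcal{M}(G,D)\in\mathbb{R}^{n\times n}$ by: $\mathcal{M}_{ii}=2$ for all $i$; $\mathcal{M}_{ij}=\mathcal{M}_{ji}=-1$ if $\{i,j\}\in D$; $\mathcal{M}_{ij}=-1$ and $\mathcal{M}_{ji}=1$ if $(i,j)\in E$; and $\mathcal{M}_{ij}=0$ otherwise. Then there exists a two-coloring $(W,B)$ of $V$ such that (i) no pair in $D$ is monochromatic and (ii) the oriented graph obtained from $G$ by reversing the direction of every edge passing between $W$ and $B$ has no cycle, if and only if there exist real numbers $u_1,\dots,u_n$ and $v_1,\dots,v_n$ such that $|\mathcal{M}_{ij}-u_iv_j|\le 3/2-0.001\,n^{-6}$ for all $i,j$.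
   Context: An oriented graph $G=(V,E)$ has vertex set $V=\{1,\dots,n\}$ and edge set $E\subset V^2$, a pair $(a,b)\in E$ being an edge passing from $a$ to $b$; there are no loops, and for distinct $a,b$ at most one of $(a,b),(b,a)$ lies in $E$. Vertices $a,b$ are adjacent if there is an edge passing between them (in either direction). A cycle is a sequence $(a_0,\dots,a_k)$, $k\ge1$, of vertices with $a_0=a_k$ and an edge passing from $a_{i-1}$ to $a_i$ for every $i$. A two-coloring of $G$ is a partition of $V$ into two disjoint sets $W$ and $B$; a subset $U\subset V$ is monochromatic if $U\subset W$ or $U\subset B$. *)

(* Defs.v *)
From mathcomp Require Import all_boot all_order all_algebra.
From mathcomp Require Import reals.

Set Implicit Arguments.
Unset Strict Implicit.
Unset Printing Implicit Defensive.

Import GRing.Theory Num.Theory.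

Local Open Scope ring_scope.

(** The vertex set {1, ..., n} is represented by ['I_n] = {0, ..., n-1};
    [(a, b) \in E] is an edge passing from [a] to [b]. *)

Definition oriented_graph n (E : {set 'I_n * 'I_n}) : Prop :=
  (forall a, (a, a) \notin E) /\
  (forall a b, a != b -> ~~ (((a, b) \in E) && ((b, a) \in E))).

Definition adjacent n (E : {set 'I_n * 'I_n}) (a b : 'I_n) : bool :=
  ((a, b) \in E) || ((b, a) \in E).

Definition nonadjacent_pairs n (E : {set 'I_n * 'I_n})
    (D : {set {set 'I_n}}) : Prop :=
  forall P, P \in D ->
    exists a b : 'I_n, [/\ a != b, ~~ adjacent E a b & P = [set a; b]].

(** [path.cycle e [:: a_0; ...; a_(k-1)]] closes the sequence implicitly: it
    asks for [e a_(i-1) a_i] for all 0 < i < k and for [e a_(k-1) a_0].  It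
    holds of the empty sequence, which k >= 1 excludes. *)
Definition has_cycle n (E : {set 'I_n * 'I_n}) : Prop :=
  exists c : seq 'I_n,
    c != [::] /\ path.cycle (fun a b => (a, b) \in E) c.

(** One of the two classes may be empty. *)
Definition two_coloring n (W B : {set 'I_n}) : Prop :=
  W :|: B = [set: 'I_n] /\ [disjoint W & B].

Definition monochromatic n (W B U : {set 'I_n}) : bool :=
  (U \subset W) || (U \subset B).

Definition between n (W B : {set 'I_n}) (a b : 'I_n) : bool :=
  ((a \in W) && (b \in B)) || ((a \in B) && (b \in W)).

Definition reverse_between n (W B : {set 'I_n}) (E : {set 'I_n * 'I_n}) :
    {set 'I_n * 'I_n} :=
  [set e : 'I_n * 'I_n | if between W B e.1 e.2 then (e.2, e.1) \in E
                         else e \in E].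

(** The cases are mutually exclusive under [oriented_graph E] and
    [nonadjacent_pairs E D]. *)
Definition coloring_matrix (R : realType) n (E : {set 'I_n * 'I_n})
    (D : {set {set 'I_n}}) : 'M[R]_n :=
  \matrix_(i, j)
    if i == j then 2
    else if [set i; j] \in D then -1
    else if (i, j) \in E then -1
    else if (j, i) \in E then 1
    else 0.

(* Main.v *)
(** Let [s] take opposite signs on [W] and [B], and let [s i] be the sign of
    [u i] and [v i].  Every edge [i -> j] of the reversed graph then asks for
    [|u i| |v j| < 1/2], while the diagonal asks for [|u i| |v i| > 1/2].  Hence
    [|v|] strictly decreases along edges, which excludes cycles; two vertices of
    the same sign paired in [D] would have to decrease in both directions.
    Conversely, from a rank function [r] of the acyclic reversed graph,
    [u i = s i q ^ (- r i)] and [v j = s j (1/2 + eps) q ^ (r j)] work for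
    [q = 1 - 1 / (2 n)]. *)

Require Import Defs.
From mathcomp Require Import all_boot all_order all_algebra.
From mathcomp Require Import reals.
From mathcomp Require Import ring lra.

Set Implicit Arguments.
Unset Strict Implicit.
Unset Printing Implicit Defensive.

Import Order.TTheory GRing.Theory Num.Theory.

Local Open Scope ring_scope.

(** By transitivity every later entry of the closed walk has a smaller [f] than the first one, and
    the closing entry is that first one. *)
Lemma cycle_decreasing_nil (T : Type) (R : numDomainType) (e : rel T)
    (f : T -> R) (c : seq T) :
  (forall a b, e a b -> f b < f a) -> path.cycle e c -> c = [::].
Proof.
move=> ef; case: c => //= x c /(sub_path (e' := fun a b => f b < f a) ef).
move/(order_path_min (fun _ _ _ yx xz => lt_trans xz yx)).
by rewrite all_rcons ltxx.
Qed.

(** The rank of a vertex counts the vertices from which it can be reached. Along an edge from [a] to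
    [b] this set gains [b] itself, since a path from [b] back to [a] would close a cycle. *)
Lemma acyclic_rank (T : finType) (e : rel T) :
  ~ (exists c : seq T, c != [::] /\ path.cycle e c) ->
  exists r : T -> nat,
    (forall a, (r a <= #|T|)%N) /\ (forall a b, e a b -> (r a < r b)%N).
Proof.
move=> acyc; exists (fun a => #|[pred k | connect e k a]|).
split=> [a|a b eab]; first exact: max_card.
apply: proper_card; apply/properP; split.
  by apply/subsetP => k; rewrite !inE => /connect_trans; apply; apply: connect1.
exists b; rewrite !inE ?connect0 //; apply/negP => /connectP[p ep lp].
by apply: acyc; exists (b :: p); rewrite /= rcons_path ep -lp eab.
Qed.

Lemma two_coloring_setC n (W B : {set 'I_n}) : two_coloring W B -> B = ~: W.
Proof.
case=> WB dWB; apply/setP => i; rewrite inE.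
have := in_setT i; rewrite -WB inE.
by case: (boolP (i \in W)) => //= iW _; rewrite (disjointFr dWB iW).
Qed.

Lemma two_coloring_compl n (W : {set 'I_n}) : two_coloring W (~: W).
Proof. by split; [exact: setUCr | rewrite -setI_eq0 setICr]. Qed.

Lemma between_setC n (W : {set 'I_n}) i j :
  between W (~: W) i j = (i \in W) (+) (j \in W).
Proof. by rewrite /between !inE; case: (i \in W); case: (j \in W). Qed.

Lemma monochromatic_setC n (W : {set 'I_n}) i j :
  monochromatic W (~: W) [set i; j] = ~~ ((i \in W) (+) (j \in W)).
Proof.
by rewrite /monochromatic !subUset !sub1set !inE; case: (i \in W); case: (j \in W).
Qed.

Lemma coloring_matrix_diag (R : realType) n E D (i : 'I_n) :
  coloring_matrix R E D i i = 2.
Proof. by rewrite mxE eqxx. Qed.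

Section Entries.
Variables (R : realType) (n : nat) (E : {set 'I_n * 'I_n}).
Variable D : {set {set 'I_n}}.
Hypotheses (hE : oriented_graph E) (hD : nonadjacent_pairs E D).

Lemma pair_neq i j : [set i; j] \in D -> i != j.
Proof.
move=> /hD[a [b [ab _ eq_ab]]]; apply: contraNneq ab => ij.
by have := cards2 a b; rewrite -eq_ab ij setUid cards1; case: eqP.
Qed.

Lemma pair_nonadjacent i j : [set i; j] \in D -> ~~ adjacent E i j.
Proof.
move=> ijD; have [a [b [ab nadj eq_ab]]] := hD ijD.
have := set21 i j; have := set22 i j; rewrite eq_ab !inE.
have ij := pair_neq ijD.
case/orP=> /eqP ej; case/orP=> /eqP ei; move: ij nadj; rewrite ei ej ?eqxx //.
by rewrite /adjacent orbC.
Qed.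

Lemma edge_neq i j : (i, j) \in E -> i != j.
Proof. by apply: contraTneq => ->; have [+ _] := hE; apply. Qed.

Lemma coloring_matrix_pair i j :
  [set i; j] \in D -> coloring_matrix R E D i j = -1.
Proof. by move=> ijD; rewrite mxE (negPf (pair_neq ijD)) ijD. Qed.

Lemma coloring_matrix_edge i j :
  (i, j) \in E -> coloring_matrix R E D i j = -1.
Proof. by move=> ijE; rewrite mxE (negPf (edge_neq ijE)) ijE if_same. Qed.

Lemma coloring_matrix_edge_rev i j :
  (j, i) \in E -> coloring_matrix R E D i j = 1.
Proof.
move=> jiE; rewrite mxE eq_sym (negPf (edge_neq jiE)) jiE.
rewrite ifN; last by apply: contraL jiE => /pair_nonadjacent/norP[].
rewrite ifN //; have [_ /(_ _ _ (edge_neq jiE))] := hE.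
by rewrite jiE.
Qed.

(** The condition on [M i j] covers pairs of [D] and edges of the reversed graph at once: the entry
    opposes the sign of [u i * u j]. It yields [|u i| |v j| <= 1/2 - eps], against
    [|u i| |v i| >= 1/2 + eps] from the diagonal. The diagonal also rules out [u a = 0], so failure
    of [0 < u a] means a negative sign. *)
Lemma ltr_norm_of_rank1_approx (M : 'M[R]_n) (u v : 'I_n -> R) (eps : R) i j :
  0 < eps -> (forall a b, `|M a b - u a * v b| <= 3 / 2 - eps) ->
  (forall a, M a a = 2) ->
  M i j = - (-1) ^+ ((0 < u i) (+) (0 < u j)) -> `|v j| < `|v i|.
Proof.
move=> eps0 Muv Mdiag Mij.
have uv a : 1 / 2 + eps <= u a * v a.
  by have := Muv a a; rewrite Mdiag ler_norml => /andP[_ ?]; lra.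
have := Muv i j; rewrite ler_norml Mij => /andP[lo hi].
have := uv i; have := uv j; move: lo hi.
case: (ltP 0 (u i)) => ui; case: (ltP 0 (u j)) => uj;
  rewrite ?expr0 ?expr1 => lo hi uvj uvi.
- have vi : 0 < v i by nra.
  have vj : 0 < v j by nra.
  by rewrite !gtr0_norm //; nra.
- have vi : 0 < v i by nra.
  have vj : v j < 0 by nra.
  by rewrite (gtr0_norm vi) (ltr0_norm vj); nra.
- have vi : v i < 0 by nra.
  have vj : 0 < v j by nra.
  by rewrite (ltr0_norm vi) (gtr0_norm vj); nra.
- have vi : v i < 0 by nra.
  have vj : v j < 0 by nra.
  by rewrite !ltr0_norm //; nra.
Qed.

Lemma two_coloring_of_rank1_approx (u v : 'I_n -> R) (eps : R) :
  0 < eps ->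
  (forall i j, `|coloring_matrix R E D i j - u i * v j| <= 3 / 2 - eps) ->
  exists W B : {set 'I_n},
    [/\ two_coloring W B, forall P, P \in D -> ~~ monochromatic W B P
      & ~ has_cycle (reverse_between W B E)].
Proof.
move=> eps0 Muv; pose W := [set i | 0 < u i].
have dec i j := ltr_norm_of_rank1_approx (i := i) (j := j) eps0 Muv
  (coloring_matrix_diag _ _ _).
exists W, (~: W); split; first exact: two_coloring_compl.
- move=> P PD; have [i [j [_ _ Pij]]] := hD PD; move: PD; rewrite {}Pij => ijD.
  rewrite monochromatic_setC negbK !inE; apply: contraT => /negPf same.
  have lt_ji : `|v j| < `|v i| by apply: dec; rewrite same coloring_matrix_pair.
  have lt_ij : `|v i| < `|v j|.
    by apply: dec; rewrite addbC same coloring_matrix_pair // setUC.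
  by have := lt_trans lt_ij lt_ji; rewrite ltxx.
- case=> c [/eqP c0 cyc]; apply: c0; move: cyc.
  apply: (cycle_decreasing_nil (f := fun i => `|v i|)) => i j.
  rewrite inE /= between_setC !inE => ijE; apply: dec; move: ijE.
  (* An edge between the classes was reversed: it comes from [(j, i)] in [E], so the entry at
     [(i, j)] is 1, as [dec] asks for opposite signs. *)
  case: ifP => _ ijE; last exact: coloring_matrix_edge.
  by rewrite expr1 opprK coloring_matrix_edge_rev.
Qed.

(** The bound [1 / (8 n)] serves the edges of the reversed graph; the bound [1 / 6] makes
    [2 (1/2 + eps) <= 4/3 <= 3/2 - eps], which serves the zero entries. *)
Lemma rank1_approx_of_two_coloring (eps : R) :
  0 <= eps -> eps <= 1 / 8 * n%:R^-1 -> eps <= 1 / 6 ->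
  (exists W B : {set 'I_n},
     [/\ two_coloring W B, forall P, P \in D -> ~~ monochromatic W B P
       & ~ has_cycle (reverse_between W B E)]) ->
  exists u v : 'I_n -> R,
    forall i j, `|coloring_matrix R E D i j - u i * v j| <= 3 / 2 - eps.
Proof.
move=> eps0 epsn eps6 [W [B [WB]]]; rewrite (two_coloring_setC WB) => Dmono.
case/acyclic_rank => r [r_le r_lt].
pose d : R := 1 / 2 * n%:R^-1; pose q := 1 - d.
pose s i : R := (-1) ^+ (i \in W).
exists (fun i => s i * q ^- r i), (fun j => s j * ((1 / 2 + eps) * q ^+ r j)).
move=> i j.
have n0 : 0 < n%:R :> R by rewrite ltr0n (leq_trans _ (ltn_ord i)).
have d_gt0 : 0 < d by apply: mulr_gt0; [lra | rewrite invr_gt0].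
have dn : n%:R * d = 1 / 2 by rewrite /d; field; lra.
have d_half : d <= 1 / 2.
  have : 1 <= n%:R :> R by rewrite ler1n -(ltr0n R).
  nra.
have q0 : 0 < q by rewrite /q; lra.
have q1 : q <= 1 by rewrite /q; lra.
(* Bernoulli's inequality; since ranks are at most [n], it keeps the ratio [p] below 2. *)
have qn : 1 / 2 <= q ^+ n.
  have : forall m, 1 - m%:R * d <= q ^+ m.
    elim=> [|m IHm]; first by rewrite expr0; lra.
    have m0 : 0 <= m%:R * d by rewrite mulr_ge0 ?ler0n //; lra.
    rewrite exprS -natr1 /q in IHm *; nra.
  by move/(_ n); rewrite dn; lra.
pose p := q ^- r i * q ^+ r j.
have qr0 k : 0 < q ^+ k by rewrite exprn_gt0.
have p0 : 0 < p by rewrite mulr_gt0 ?invr_gt0.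
have p2 : p <= 2.
  have qr_half : 1 / 2 <= q ^+ r i.
    apply: le_trans qn _.
    by rewrite ler_wiXn2l ?(ltW q0) // -[leqRHS]card_ord.
  rewrite /p mulrC ler_pdivrMr //.
  have : q ^+ r j <= 1 by rewrite exprn_ile1 // ltW.
  lra.
have p_lt : (r i < r j)%N -> p <= q.
  move=> rij; rewrite /p mulrC ler_pdivrMr // -exprS.
  by rewrite ler_wiXn2l ?(ltW q0).
rewrite (_ : _ * _ * _ = (-1) ^+ ((i \in W) (+) (j \in W)) * ((1 / 2 + eps) * p));
  last by rewrite /s /p signr_addb; ring.
have r_edge : (if (i \in W) (+) (j \in W) then (j, i) \in E else (i, j) \in E) ->
    (1 / 2 + eps) * p <= 1 / 2 - eps.
  move=> ijE; have /p_lt : (r i < r j)%N by apply: r_lt; rewrite inE /= between_setC.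
  (* [(1/2 + eps) (1 - d) <= 1/2 - eps] follows from [2 eps <= d / 2]. *)
  rewrite /q => pq; have : eps <= d / 4 by rewrite /d; lra.
  nra.
have hi : (1 / 2 + eps) * p <= 4 / 3 by nra.
have lo : 0 < (1 / 2 + eps) * p by nra.
rewrite ler_norml.
have [eq_ij|ij] := eqVneq i j.
  have p1 : p = 1 by rewrite /p eq_ij mulVf ?gt_eqF.
  by rewrite eq_ij coloring_matrix_diag addbb p1 expr0; apply/andP; split; lra.
rewrite mxE (negPf ij); case: ifP => [/Dmono|_].
  rewrite monochromatic_setC negbK => ->; rewrite expr1.
  by apply/andP; split; lra.
(* Only an edge of the reversed graph from [i] to [j] gives an entry opposing the sign of the
   product and needs [r_edge]. Otherwise the entry is 0 or has the same sign, and [lo] and [hi]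
   suffice. *)
move: r_edge; case: ((i \in W) (+) (j \in W)); rewrite ?expr0 ?expr1.
  case: ifP => _; first by move=> _; apply/andP; split; lra.
  case: ifP => _ r_edge; last by apply/andP; split; lra.
  by have := r_edge isT; move=> ?; apply/andP; split; lra.
case: ifP => _ r_edge.
  by have := r_edge isT; move=> ?; apply/andP; split; lra.
by case: ifP => _; apply/andP; split; lra.
Qed.

End Entries.

Theorem theorem2 (R : realType) (n : nat) (E : {set 'I_n * 'I_n})
    (D : {set {set 'I_n}})
    (hE : oriented_graph E) (hD : nonadjacent_pairs E D) :
  (exists W B : {set 'I_n},
     [/\ two_coloring W B,
         forall P, P \in D -> ~~ monochromatic W B P
       & ~ has_cycle (reverse_between W B E)])
  <->
  (exists u v : 'I_n -> R, forall i j : 'I_n,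
     `|coloring_matrix R E D i j - u i * v j|
       <= 3 / 2 - 10 ^- 3 * n%:R ^- 6).
Proof.
(* For [n = 0] the inverse power is 0 by convention, so the margin is not positive; both sides then
   hold trivially. *)
have [n0|n_gt0] := posnP n.
  subst n; split=> _; first by exists (fun=> 0), (fun=> 0); case.
  exists set0, (~: set0); split; first exact: two_coloring_compl.
    by move=> P /hD[a]; have := ltn_ord a.
  by case=> -[[//]|a c]; have := ltn_ord a.
have n1 : 1 <= n%:R :> R by rewrite ler1n.
split=> [|[u [v]]]; last first.
  apply: (two_coloring_of_rank1_approx hE hD).
  by rewrite mulr_gt0 ?invr_gt0 ?exprn_gt0 ?ltr0n.
have i1 : n%:R^-1 <= 1 :> R by rewrite invf_le1 // ltr0n.
have i0 : 0 <= n%:R^-1 :> R by rewrite invr_ge0 ler0n.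
(* Together with [10 ^- 3 <= 1 / 8] this puts the margin below [1 / (8 n)], hence below [1 / 6]. *)
have le_inv : n%:R ^- 6 <= n%:R^-1 :> R.
  by rewrite -exprVn ler_iXnr.
have inv6_ge0 : 0 <= n%:R ^- 6 :> R by rewrite -exprVn exprn_ge0.
have t0 : 0 < 10 ^- 3 :> R by rewrite invr_gt0 exprn_gt0.
have t1 : 10 ^- 3 <= 1 / 8 :> R.
  by rewrite -exprVn; lra.
apply: rank1_approx_of_two_coloring => //; nra.
Qed.
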